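(* Let $T_5$ be the $5$-regular tree. Then $\mathrm{md}(\mathrm{Aut}(T_5))=5$; in particular $T_5$ is a Cayley–Abels graph of minimal degree for $\mathrm{Aut}(T_5)$.
   Context: $\mathrm{Aut}(T_5)$ carries the permutation topology (pointwise stabilizers of finite vertex sets form a neighbourhood basis of the identity), making it a totally disconnected, locally compact group. A Cayley–Abels graph for such a group $G$ is a connected, locally finite simple graph with an action of $G$ by automorphisms (not necessarily faithful) that is vertex-transitive with compact open vertex stabilizers; $\mathrm{md}(G)$ is the minimal degree of such a graph. *)

(* Defs.v *)
From Stdlib Require Import List Relations.
From mathcomp Require Import all_boot.
Set Implicit Arguments. Unset Strict Implicit. Unset Printing Implicit Defensive.

(* ---------- The 5-regular tree T_5 ----------
   Vertices: reduced words over the alphabet 'I_5 (no two consecutive letters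
   equal), i.e. elements of the free product of five copies of Z/2;
   two words are adjacent iff one is obtained from the other by adding one
   letter at the front.  This is the Cayley graph of Z/2*...*Z/2 (5 factors),
   the 5-regular tree. *)
Definition reduced (s : seq 'I_5) : bool := sorted (fun a b : 'I_5 => a != b) s.
Definition T5 : Type := {s : seq 'I_5 | reduced s}.
Definition T5adj (x y : T5) : Prop :=
  (proj1_sig x = behead (proj1_sig y) /\ size (proj1_sig y) = (size (proj1_sig x)).+1)
  \/ (proj1_sig y = behead (proj1_sig x) /\ size (proj1_sig x) = (size (proj1_sig y)).+1).

Definition is_graph_aut (V : Type) (adj : V -> V -> Prop) (f : V -> V) : Prop :=
  bijective f /\ forall x y, adj x y <-> adj (f x) (f y).
Definition Aut (V : Type) (adj : V -> V -> Prop) : Type := {f : V -> V | is_graph_aut adj f}.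
Definition autf V adj (g : @Aut V adj) : V -> V := proj1_sig g.

(* Permutation topology: the sets {h | h = g on F}, F finite, form a
   neighbourhood basis of g (these are the cosets g * Stab(F)). *)
Definition perm_open V adj (U : @Aut V adj -> Prop) : Prop :=
  forall g, U g -> exists F : list V,
    forall h, (forall x, In x F -> autf h x = autf g x) -> U h.

Definition perm_compact V adj (K : @Aut V adj -> Prop) : Prop :=
  forall (I : Type) (U : I -> @Aut V adj -> Prop),
    (forall i, perm_open (U i)) ->
    (forall g, K g -> exists i, U i g) ->
    exists l : list I, forall g, K g -> exists i, In i l /\ U i g.

Definition deg_at (W : Type) (adjW : W -> W -> Prop) (w : W) (d : nat) : Prop :=
  exists l : list W, NoDup l /\ length l = d /\ forall y, adjW w y <-> In y l.

Definition is_cayley_abels V adj (W : Type) (adjW : W -> W -> Prop)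
    (act : @Aut V adj -> W -> W) : Prop :=
  (forall x y, adjW x y -> adjW y x) /\ (forall x, ~ adjW x x) /\
  (forall x y, clos_refl_trans W adjW x y) /\
  (forall x, exists l : list W, forall y, adjW x y -> In y l) /\
  (forall g w, (forall x, autf g x = x) -> act g w = w) /\
  (forall g h k w, (forall x, autf k x = autf g (autf h x)) ->
      act k w = act g (act h w)) /\
  (forall g, is_graph_aut adjW (act g)) /\
  (forall x y, exists g, act g x = y) /\
  (forall w, perm_open (fun g => act g w = w) /\ perm_compact (fun g => act g w = w)).

Definition md_is V adj (d : nat) : Prop :=
  (exists (W : Type) (adjW : W -> W -> Prop) (act : @Aut V adj -> W -> W),
      is_cayley_abels adjW act /\ exists w, deg_at adjW w d) /\
  (forall (W : Type) (adjW : W -> W -> Prop) (act : @Aut V adj -> W -> W),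
      is_cayley_abels adjW act -> forall w d', deg_at adjW w d' -> d <= d').

Definition T5act (g : Aut T5adj) (v : T5) : T5 := autf g v.

(* Main.v *)
Require Import Defs.
From Stdlib Require Import List Relations Classical ClassicalEpsilon FinFun.
From HB Require Import structures.
From mathcomp Require Import all_boot.
From mathcomp Require Import zify.

(** An element [g] of [Aut T5] of positive translation length [l] has scale at
    least [4 ^ l]: if [K] is the stabilizer of a vertex [w] of a Cayley-Abels
    graph, then the [K]-orbit of [g w] has at least [4 ^ l] elements.  In a graph of degree at most 4 an
    element [s] moving [w] to a neighbour is therefore elliptic, since [s ^ 2]
    would need an orbit of 16 points among at most 4 * 3 non-backtracking paths.
    Some [K]-orbit of neighbours has at least 3 elements, as otherwise every
    element of order 3 of [K] would act trivially on the graph.  Hence at most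
    one neighbour [t w] lies outside such an orbit [K s w], it is fixed by [K],
    and [s t] is elliptic because [K s t w] has at most 3 elements.  By Serre's
    lemma on groups generated by elliptic elements with elliptic pairwise
    products, [K], [s] and [t] have a common fixed point in the tree; but they
    generate [Aut T5], which has unbounded orbits. *)

Set Implicit Arguments.
Unset Strict Implicit.
Unset Printing Implicit Defensive.

HB.instance Definition _ := Countable.copy T5 {s : seq 'I_5 | reduced s}.

(** * The tree metric *)

Fixpoint lcp (s t : seq 'I_5) : nat :=
  match s, t with
  | a :: s', b :: t' => if a == b then (lcp s' t').+1 else 0
  | _, _ => 0
  end.

Lemma lcpC (s t : seq 'I_5) : lcp s t = lcp t s.
Proof. by elim: s t => [|a s IH] [|b t] //=; rewrite eq_sym IH. Qed.

Lemma lcpxx (s : seq 'I_5) : lcp s s = size s.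
Proof. by elim: s => //= a s ->; rewrite eqxx. Qed.

Lemma lcp_le (s t : seq 'I_5) : lcp s t <= size s.
Proof. by elim: s t => [|a s IH] [|b t] //=; case: ifP => // _; apply: IH. Qed.

Lemma lcp_ultra (s t u : seq 'I_5) :
  minn (lcp s t) (lcp t u) <= lcp s u.
Proof.
elim: t s u => [|b t IH] [|a s] [|c u] //=; rewrite ?minn0 ?min0n //.
case: (a =P b) => [->|_]; last by rewrite min0n.
by case: eqP => [_|_]; rewrite ?minn0 // minnSS ltnS.
Qed.

Lemma lcp_rcons (s t : seq 'I_5) (a : 'I_5) :
  lcp (rcons s a) t <= size s -> lcp s t = lcp (rcons s a) t.
Proof.
elim: s t => [|b s IH] [|c t] //=; first by case: ifP.
by case: eqP => // _; rewrite ltnS => /IH->.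
Qed.

Lemma lcp_full (s t : seq 'I_5) :
  lcp s t = size s -> lcp s t = size t -> s = t.
Proof.
elim: s t => [|a s IH] [|b t] //=.
by case: eqP => // -> [/IH h] [/h ->].
Qed.

Lemma lcp_child (s : seq 'I_5) (a : 'I_5) : lcp s (rcons s a) = size s.
Proof. by elim: s => //= b s ->; rewrite eqxx. Qed.

Definition wd (x : T5) : seq 'I_5 := proj1_sig x.

Lemma wd_inj : injective wd.
Proof. exact: val_inj. Qed.

Definition origin : T5 := exist (fun s => reduced s) [::] isT.

(* Words grow at the front, so the geodesics from the root to [x] and [y] share
   their common suffix. *)
Definition dist (x y : T5) : nat :=
  size (wd x) + size (wd y) - 2 * lcp (rev (wd x)) (rev (wd y)).

Lemma lcpT_le (x y : T5) :
  (lcp (rev (wd x)) (rev (wd y)) <= size (wd x)) /\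
  (lcp (rev (wd x)) (rev (wd y)) <= size (wd y)).
Proof.
split; first by have := lcp_le (rev (wd x)) (rev (wd y)); rewrite size_rev.
by rewrite lcpC; have := lcp_le (rev (wd y)) (rev (wd x)); rewrite size_rev.
Qed.

Lemma distC (x y : T5) : dist x y = dist y x.
Proof. by rewrite /dist lcpC addnC. Qed.

Lemma distxx (x : T5) : dist x x = 0.
Proof. by rewrite /dist lcpxx size_rev; lia. Qed.

Lemma dist_origin (x : T5) : dist origin x = size (wd x).
Proof. by rewrite /dist /= muln0 subn0. Qed.

Lemma dist_four_point (x y z t : T5) :
  dist x y + dist z t <= maxn (dist x z + dist y t) (dist x t + dist y z).
Proof.
rewrite /dist.
have [? ?] := lcpT_le x y; have [? ?] := lcpT_le z t.
have [? ?] := lcpT_le x z; have [? ?] := lcpT_le y t.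
have [? ?] := lcpT_le x t; have [? ?] := lcpT_le y z.
have u a b c := lcp_ultra (rev (wd a)) (rev (wd b)) (rev (wd c)).
have := u x z y; have := u x t y; have := u z x t; have := u z y t.
rewrite (lcpC (rev (wd z)) (rev (wd y))) (lcpC (rev (wd t)) (rev (wd y))).
rewrite (lcpC (rev (wd z)) (rev (wd x))).
lia.
Qed.

Lemma dist_triangle (x y z : T5) : dist x z <= dist x y + dist y z.
Proof.
have := dist_four_point x z y y; rewrite distxx addn0 maxnn.
by rewrite (distC z y).
Qed.

Lemma dist_adj (x y : T5) : T5adj x y -> dist x y <= 1.
Proof.
have h a b : wd a = behead (wd b) -> size (wd b) = (size (wd a)).+1 ->
    dist a b <= 1.
  rewrite /dist; case: (wd b) => // c s /= -> _.
  by rewrite rev_cons lcp_child size_rev; lia.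
by case=> -[]; [exact: h | rewrite distC; exact: h].
Qed.

Lemma adj_sym (x y : T5) : T5adj x y -> T5adj y x.
Proof. by case; [right | left]. Qed.

Lemma reduced_behead s : reduced s -> reduced (behead s).
Proof. by case: s => //= a s; apply: path_sorted. Qed.

Definition parent (x : T5) : T5 :=
  exist (fun s => reduced s) (behead (wd x)) (reduced_behead (proj2_sig x)).

Lemma adj_parent (x : T5) : wd x != [::] -> T5adj x (parent x).
Proof. by move=> h; right; split => //=; rewrite -/(wd x); case: (wd x) h. Qed.

Lemma dist_parent (x y : T5) :
  lcp (rev (wd x)) (rev (wd y)) < size (wd x) ->
  [/\ wd x != [::], size (wd (parent x)) < size (wd x) &
     dist x y = (dist (parent x) y).+1].
Proof.
have [_] := lcpT_le x y; rewrite /dist /=.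
case: (wd x) => // a s /=; rewrite rev_cons => h1 h2; split => //.
by rewrite (lcp_rcons (s := rev s) (a := a)) ?size_rev //; lia.
Qed.

Lemma nonexpansive_of_adj (f : T5 -> T5) :
  (forall x y, T5adj x y -> T5adj (f x) (f y)) ->
  forall x y, dist (f x) (f y) <= dist x y.
Proof.
move=> hf x y; have [n] := ubnP (size (wd x) + size (wd y)).
elim: n x y => // n IH x y hn.
have [e1 e2] := lcpT_le x y.
have step a b : lcp (rev (wd a)) (rev (wd b)) < size (wd a) ->
    size (wd a) + size (wd b) < n.+1 -> dist (f a) (f b) <= dist a b.
  move=> /dist_parent [h1 h2 ->] h.
  have h3 : dist (f (parent a)) (f b) <= dist (parent a) b by apply: IH; lia.
  have := dist_triangle (f a) (f (parent a)) (f b).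
  have := dist_adj (hf _ _ (adj_parent h1)); lia.
case: (ltnP (lcp (rev (wd x)) (rev (wd y))) (size (wd x))) => [h|h1].
  exact: step.
case: (ltnP (lcp (rev (wd x)) (rev (wd y))) (size (wd y))) => [h|h2].
  by rewrite distC (distC x); apply: step; [rewrite lcpC | rewrite addnC].
have e : x = y.
  by apply/wd_inj/(can_inj revK)/lcp_full; rewrite size_rev; apply/eqP;
     rewrite eqn_leq ?e1 ?e2 ?h1 ?h2.
by rewrite e distxx.
Qed.

(** * Automorphisms of the tree *)

Notation G := (Aut T5adj).

Lemma aut_adj (g : G) (x y : T5) : T5adj x y <-> T5adj (autf g x) (autf g y).
Proof. exact: (proj2 (proj2_sig g)). Qed.

Lemma comp_is_aut (g h : G) : is_graph_aut T5adj (autf g \o autf h).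
Proof.
split; first by apply: bij_comp; [case: (proj2_sig g)|case: (proj2_sig h)].
by move=> x y; rewrite /= (aut_adj h) (aut_adj g).
Qed.

Definition gcomp (g h : G) : G := exist _ _ (comp_is_aut g h).

Lemma id_is_aut : is_graph_aut T5adj id.
Proof. by split; [exists id|]. Qed.

Definition gone : G := exist _ _ id_is_aut.

Lemma ginv_ex (g : G) :
  exists h : G, cancel (autf g) (autf h) /\ cancel (autf h) (autf g).
Proof.
case: (proj1 (proj2_sig g)) => f gK fK.
have hf : is_graph_aut T5adj f.
  split; first by exists (autf g).
  by move=> x y; rewrite (aut_adj g (f x) (f y)) /autf !fK.
by exists (exist _ f hf).
Qed.

Definition ginv (g : G) : G :=
  proj1_sig (constructive_indefinite_description _ (ginv_ex g)).

Lemma autK (g : G) : cancel (autf g) (autf (ginv g)).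
Proof. by rewrite /ginv; case: constructive_indefinite_description => h []. Qed.

Lemma autVK (g : G) : cancel (autf (ginv g)) (autf g).
Proof. by rewrite /ginv; case: constructive_indefinite_description => h []. Qed.

Fixpoint gpow (g : G) (n : nat) : G :=
  if n is m.+1 then gcomp g (gpow g m) else gone.

Lemma gpowD (g : G) m n x :
  autf (gpow g (m + n)) x = autf (gpow g m) (autf (gpow g n) x).
Proof. by elim: m => // m IH; apply: (congr1 (autf g) IH). Qed.

Lemma dist_aut (g : G) (x y : T5) : dist (autf g x) (autf g y) = dist x y.
Proof.
have le (h : G) a b : dist (autf h a) (autf h b) <= dist a b.
  by apply: nonexpansive_of_adj => c d; apply: (proj1 (aut_adj h c d)).
apply/eqP; rewrite eqn_leq le /=.
by rewrite -{1}(autK g x) -{1}(autK g y) le.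
Qed.

(** * Centres of finite sets and elliptic automorphisms *)

Definition span (A B : seq T5) : nat :=
  \max_(a <- A) \max_(b <- B) dist a b.

Lemma span_leP (A B : seq T5) (n : nat) :
  reflect (forall a b, a \in A -> b \in B -> dist a b <= n) (span A B <= n).
Proof.
apply: (iffP (bigmax_leqP_seq _ _ _ _)) => [h a b ha hb|h a ha _].
  by move/bigmax_leqP_seq: (h a ha isT); apply.
by apply/bigmax_leqP_seq => b hb _; apply: h.
Qed.

Lemma dist_le_span (A B : seq T5) (a b : T5) :
  a \in A -> b \in B -> dist a b <= span A B.
Proof. by move/span_leP: (leqnn (span A B)); apply. Qed.

Lemma bigmax_attained (T : eqType) (F : T -> nat) (s : seq T) :
  s != [::] -> exists2 x, x \in s & \max_(y <- s) F y = F x.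
Proof.
elim: s => // x s IH _; rewrite big_cons.
case: (altP (s =P [::])) => [->|/IH [y ys ->]].
  by rewrite big_nil maxn0; exists x; rewrite ?mem_head.
case: (leqP (F x) (F y)) => _; last by exists x; rewrite ?mem_head.
by exists y; rewrite // inE ys orbT.
Qed.

Lemma span_attained (A B : seq T5) : A != [::] -> B != [::] ->
  exists a b, [/\ a \in A, b \in B & span A B = dist a b].
Proof.
move=> /bigmax_attained nA /bigmax_attained nB.
have [a ha e] := nA (fun a => \max_(b <- B) dist a b).
have [b hb e'] := nB (dist a).
by exists a, b; split=> //; rewrite /span e.
Qed.

Lemma spanC (A B : seq T5) : span A B = span B A.
Proof.
have le C D : span C D <= span D C.
  by apply/span_leP => c d hc hd; rewrite distC dist_le_span.
by apply/eqP; rewrite eqn_leq !le.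
Qed.

(* Taking sets instead of points amounts to working with midpoints of the
   tree: [span A B] is the distance between the centres of [A] and [B] plus
   both radii, so the four point condition survives. *)
Lemma span_four_point (A B C D : seq T5) :
  A != [::] -> B != [::] -> C != [::] -> D != [::] ->
  span A B + span C D <= maxn (span A C + span B D) (span A D + span B C).
Proof.
move=> nA nB nC nD.
have [a [b [ha hb ->]]] := span_attained nA nB.
have [c [d [hc hd ->]]] := span_attained nC nD.
have := dist_four_point a b c d.
have := dist_le_span ha hc; have := dist_le_span hb hd.
have := dist_le_span ha hd; have := dist_le_span hb hc; lia.
Qed.

Lemma span_triangle (A B C : seq T5) :
  A != [::] -> B != [::] -> C != [::] ->
  span A C + span B B <= span A B + span B C.
Proof.
move=> nA nB nC; have := span_four_point nA nC nB nB.
by rewrite maxnn (spanC C B).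
Qed.

Lemma span_cat_le (A B C D : seq T5) (n : nat) :
  span A C <= n -> span A D <= n -> span B C <= n -> span B D <= n ->
  span (A ++ B) (C ++ D) <= n.
Proof.
move=> /span_leP h1 /span_leP h2 /span_leP h3 /span_leP h4.
apply/span_leP => a b; rewrite !mem_cat => /orP[ha|ha] /orP[hb|hb];
  [exact: h1|exact: h2|exact: h3|exact: h4].
Qed.

Definition img (g : G) (A : seq T5) : seq T5 := map (autf g) A.

Lemma img_neq0 (g : G) (A : seq T5) : A != [::] -> img g A != [::].
Proof. by case: A. Qed.

Lemma img_comp (g h : G) (A : seq T5) : img (gcomp g h) A = img g (img h A).
Proof. by rewrite /img -map_comp. Qed.

Lemma span_img (g : G) (A B : seq T5) : span (img g A) (img g B) = span A B.
Proof.
rewrite /span big_map; apply: eq_bigr => a _.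
by rewrite big_map; apply: eq_bigr => b _; rewrite dist_aut.
Qed.

Lemma img_cat (g : G) (A B : seq T5) : img g (A ++ B) = img g A ++ img g B.
Proof. exact: map_cat. Qed.

Lemma img_gone (A : seq T5) : img gone A = A.
Proof. exact: map_id. Qed.

Lemma img_pow_swap (g : G) (n : nat) (A : seq T5) :
  img (gpow g n.+1) A = img (gpow g n) (img g A).
Proof.
rewrite /img -map_comp; apply: eq_map => x.
by have := gpowD g n 1 x; rewrite addn1.
Qed.

(* [g] has positive translation length exactly when it fails this test, whatever
   the nonempty set [A]. *)
Definition elliptic_at (A : seq T5) (g : G) : bool :=
  span A (img g (img g A)) <= span A (img g A).

(* Since [span A (img g A)] is the diameter of [A] plus the displacement of the
   centre of [A], equality with the diameter means that [g] fixes that centre. *)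
Definition fixes_center (A : seq T5) (g : G) : bool :=
  span A (img g A) <= span A A.

Lemma span_pow_growth (A : seq T5) (g : G) : A != [::] -> ~~ elliptic_at A g ->
  forall n, n <= span A (img (gpow g n) A).
Proof.
rewrite /elliptic_at -ltnNge => nA hyp.
pose a n := span A (img (gpow g n) A).
have a1 : a 1 = span A (img g A) by [].
have a2 : a 2 = span A (img g (img g A)) by rewrite /a /= !img_comp img_gone.
suff h n : a 1 < a n.+2 /\ a n.+1 < a n.+2.
  elim=> // -[_|n IH].
    have := span_triangle nA (img_neq0 g nA) (img_neq0 g (img_neq0 g nA)).
    by rewrite -/(a 1) a1 !span_img; lia.
  by have [_] := h n; move: IH; rewrite -/(a n.+1) -/(a n.+2); lia.
elim: n => [|n [IH1 IH2]]; first by rewrite a2 a1.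
have pow_img k : img (gpow g k) A != [::] by exact: img_neq0.
have := span_four_point nA (pow_img n.+2) (img_neq0 g nA) (pow_img n.+3).
have s k : span (img g A) (img (gpow g k.+1) A) = a k.
  by rewrite (img_comp g) span_img.
have -> : span (img (gpow g n.+2) A) (img (gpow g n.+3) A) = a 1.
  by rewrite (img_pow_swap g n.+2) span_img.
rewrite (spanC (img (gpow g n.+2) A)) !s.
rewrite -/(a n.+2) -/(a n.+3) -a1; lia.
Qed.

Lemma fixes_center_join_self (A : seq T5) (t : G) :
  A != [::] -> elliptic_at A t -> fixes_center (A ++ img t A) t.
Proof.
move=> nA el.
have h : span A (img t A) <= span (A ++ img t A) (A ++ img t A).
  by apply/span_leP => a b ha hb; rewrite dist_le_span // mem_cat ?ha ?hb ?orbT.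
have := span_triangle nA (img_neq0 t nA) nA.
rewrite span_img (spanC (img t A)) => tri.
apply: leq_trans h; rewrite img_cat; apply: span_cat_le => //.
  by rewrite span_img; lia.
by rewrite span_img.
Qed.

(* If [h] and [t] are elliptic with product elliptic, then their fixed trees
   meet, so the projection of a fixed point of [h] onto the fixed tree of [t]
   is again fixed by [h]. *)
Lemma fixes_center_join (A : seq T5) (h t : G) :
  A != [::] -> fixes_center A h -> elliptic_at A t ->
  elliptic_at A (gcomp h t) -> fixes_center (A ++ img t A) h.
Proof.
rewrite /elliptic_at /fixes_center !img_comp => nA hA tA htA.
have n1 := img_neq0 t nA; have n2 := img_neq0 h nA.
have n3 := img_neq0 h n1; have n4 := img_neq0 t n3; have n5 := img_neq0 h n4.
have n6 := img_neq0 (ginv t) nA.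
have top : span A (img t A) <= span (A ++ img t A) (A ++ img t A).
  by apply/span_leP => a b ha hb; rewrite dist_le_span // mem_cat ?ha ?hb ?orbT.
have self : span A A <= span A (img t A).
  have := span_triangle nA n1 nA; rewrite span_img (spanC (img t A)); lia.
have ht : span A (img h (img t A)) <= span A (img t A).
  by have := span_triangle nA n2 n3; rewrite !span_img; lia.
have th : span (img t A) (img h A) <= span A (img t A).
  have := span_triangle n1 nA n2; rewrite (spanC (img t A) A); lia.
have tht : span A (img t (img h (img t A))) <= span A (img t A).
  have := span_triangle n2 nA n5; rewrite !span_img (spanC (img h A) A); lia.
apply: leq_trans top; rewrite img_cat; apply: span_cat_le => //.
  exact: leq_trans hA _.
have := span_four_point n1 n3 n6 nA.
have e B : span B (img (ginv t) A) = span (img t B) A.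
  by rewrite -(span_img t) /img -[X in span _ X]map_comp
     (@eq_map _ _ (autf t \o autf (ginv t)) id (autVK t)) map_id.
rewrite (spanC (img (ginv t) A)) !e !(spanC (img t _) A).
by rewrite (spanC (img h (img t A)) A); lia.
Qed.

Lemma fixes_center_comp (A : seq T5) (g h : G) : A != [::] ->
  fixes_center A g -> fixes_center A h -> fixes_center A (gcomp g h).
Proof.
rewrite /fixes_center img_comp => nA hg hh.
have := span_triangle nA (img_neq0 g nA) (img_neq0 g (img_neq0 h nA)).
rewrite !span_img; lia.
Qed.

(** * Constructing automorphisms *)

Definition word_adj (s t : seq 'I_5) : Prop :=
  (s = behead t /\ size t = (size s).+1) \/ (t = behead s /\ size s = (size t).+1).

Lemma build_aut (f f' : seq 'I_5 -> seq 'I_5) :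
  (forall s, reduced s -> reduced (f s)) ->
  (forall s, reduced s -> reduced (f' s)) ->
  (forall s, reduced s -> f' (f s) = s) ->
  (forall s, reduced s -> f (f' s) = s) ->
  (forall a s, reduced (a :: s) -> word_adj (f (a :: s)) (f s)) ->
  (forall a s, reduced (a :: s) -> word_adj (f' (a :: s)) (f' s)) ->
  exists g : G, forall x, wd (autf g x) = f (wd x).
Proof.
move=> rf rf' fK f'K af af'.
pose F (h : seq 'I_5 -> seq 'I_5) (rh : forall s, reduced s -> reduced (h s))
  (x : T5) : T5 := exist (fun s => reduced s) (h (wd x)) (rh _ (proj2_sig x)).
have adjF h rh : (forall a s, reduced (a :: s) -> word_adj (h (a :: s)) (h s)) ->
    forall x y, T5adj x y -> T5adj (F h rh x) (F h rh y).
  move=> ah x y; rewrite /T5adj /= -/(wd x) -/(wd y).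
  have rx : reduced (wd x) := proj2_sig x; have ry : reduced (wd y) := proj2_sig y.
  case=> -[e1 e2].
    move: e1 e2 ry; case: (wd y) => //= b s -> _ ry.
    by case: (ah b s ry); [right | left].
  move: e1 e2 rx; case: (wd x) => //= b s -> _ rx.
  by case: (ah b s rx); [left | right].
have FK : cancel (F f rf) (F f' rf').
  by move=> x; apply: wd_inj; apply: fK; apply: (proj2_sig x).
have F'K : cancel (F f' rf') (F f rf).
  by move=> x; apply: wd_inj; apply: f'K; apply: (proj2_sig x).
have is_aut : is_graph_aut T5adj (F f rf).
  split; first by exists (F f' rf').
  move=> x y; split; first exact: adjF.
  by move/(adjF _ rf' af'); rewrite !FK.
by exists (exist _ _ is_aut).
Qed.

(* Right multiplication by the letter [c] in the free product. *)
Fixpoint rmul (c : 'I_5) (s : seq 'I_5) : seq 'I_5 :=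
  if s is a :: s' then if nilp s' && (a == c) then [::] else a :: rmul c s'
  else [:: c].

Lemma reduced_cons a s : reduced (a :: s) = (ohead s != Some a) && reduced s.
Proof. by case: s => //= b s; rewrite eq_sym. Qed.

Lemma rmul_nil c s : (rmul c s == [::]) = (s == [:: c]).
Proof.
case: s => //= a s; case: s => [|b s] /=; last by rewrite !eqseq_cons andbF.
by rewrite eqseq_cons andbT; case: ifP.
Qed.

Lemma rmul_reduced c s : reduced s -> reduced (rmul c s).
Proof.
elim: s => // a s IH; rewrite reduced_cons => /andP[h /IH r] /=.
case: ifP => // e; rewrite reduced_cons r andbT.
case: s h e {IH r} => [|b s] /=; first by move=> _; rewrite eq_sym => /negbT.
by case: ifP.
Qed.

Lemma rmulK c s : reduced s -> rmul c (rmul c s) = s.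
Proof.
elim: s => [|a s IH]; first by rewrite /= eqxx.
rewrite reduced_cons => /andP[h /IH r] /=; case: ifP => /=.
  by case/andP=> /nilP -> /eqP ->.
move=> _; rewrite r /nilp size_eq0 rmul_nil; case: ifP => // /andP[/eqP e /eqP e'].
by move: h; rewrite e e' /= eqxx.
Qed.

Lemma rmul_adj c a s : word_adj (rmul c (a :: s)) (rmul c s).
Proof.
rewrite /=; case: ifP => [/andP[/nilP -> _]|_]; first by left.
by right.
Qed.

Lemma rmul_rcons c s : reduced (rcons s c) -> rmul c s = rcons s c.
Proof.
elim: s => //= a s IH; rewrite -/(reduced _) => h.
have /= -> := IH (path_sorted h).
case: s h {IH} => //= /andP[h _].
by rewrite (negbTE h).
Qed.

Lemma aut_transitive (x y : T5) : exists g : G, autf g x = y.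
Proof.
have from_root z : exists g : G, autf g origin = z.
  have [n] := ubnP (size (wd z)); elim: n z => // n IH z.
  have rz : reduced (wd z) := proj2_sig z.
  case/lastP e : (wd z) rz => [|s c] rz.
    by exists gone; apply: wd_inj; rewrite e.
  rewrite size_rcons => hs.
  have rs : reduced s by case: s rz {e hs} => //= a s; rewrite rcons_path => /andP[].
  have [g hg] := IH (exist (fun s => reduced s) s rs) hs.
  have [h hh] := build_aut (@rmul_reduced c) (@rmul_reduced c) (@rmulK c)
    (@rmulK c) (fun a s _ => rmul_adj c a s) (fun a s _ => rmul_adj c a s).
  exists (gcomp h g); apply: wd_inj; rewrite /autf /= -/(autf h _) hh -/(autf g origin).
  by rewrite hg /= rmul_rcons.
have [g <-] := from_root x; have [h <-] := from_root y.
by exists (gcomp h (ginv g)); rewrite /autf /= -!/(autf _ _) autK.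
Qed.

(* Relabelling by [p] everything beyond the vertex [u]. *)
Fixpoint twist (u : seq 'I_5) (p : 'I_5 -> 'I_5) (s : seq 'I_5) : seq 'I_5 :=
  if s is a :: s' then (if suffix u s' then p a else a) :: twist u p s'
  else [::].

Lemma twist_small u p s : size s <= size u -> twist u p s = s.
Proof.
elim: s => //= a s IH h; rewrite IH ?(ltnW h) //.
by case: ifP => // /size_suffix; rewrite leqNgt h.
Qed.

Lemma twist_beyond u p z : twist u p (z ++ u) = map p z ++ u.
Proof.
elim: z => [|a z IH] /=; first by rewrite twist_small.
by rewrite suffix_suffix IH.
Qed.

Lemma twist_off u p s : ~~ suffix u s -> twist u p s = s.
Proof.
elim: s => //= a s IH h.
have h' : ~~ suffix u s by apply: contra h => /suffixP[z ->]; apply: (suffix_suffix (a :: z)).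
by rewrite IH // (negbTE h').
Qed.

Lemma suffix_twist u p s : suffix u (twist u p s) = suffix u s.
Proof.
case: (boolP (suffix u s)) => [/suffixP[z ->]|h]; last first.
  by rewrite twist_off //; apply/negbTE.
by rewrite twist_beyond suffix_suffix.
Qed.

Lemma twistK u p p' : cancel p p' -> cancel (twist u p) (twist u p').
Proof.
move=> pK; elim=> //= a s ->; rewrite suffix_twist.
by case: (suffix u s); rewrite ?pK.
Qed.

Lemma twist_reduced u p s : injective p -> (forall b, ohead u = Some b -> p b = b) ->
  reduced s -> reduced (twist u p s).
Proof.
move=> pI pu; elim: s => // a s IH; rewrite reduced_cons => /andP[h /IH r].
have -> : twist u p (a :: s) = (if suffix u s then p a else a) :: twist u p s by [].
rewrite reduced_cons r andbT; case: s h {IH r} => //= b s h.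
case: (boolP (suffix u s)) => [hs|hs].
  rewrite (suffix_trans hs (suffix_cons s b)).
  by apply: contra h => /eqP[/pI ->]; rewrite eqxx.
case: ifP => // /suffixP[[|c z] /=]; last by case=> _ es; rewrite es suffix_suffix in hs.
move=> eu; apply: contra h => /eqP[]; rewrite -{1}(pu b) -?eu // => /pI ->.
by rewrite eqxx.
Qed.

Lemma twist_aut u (p p' : 'I_5 -> 'I_5) : cancel p p' -> cancel p' p ->
  (forall b, ohead u = Some b -> p b = b) ->
  exists g : G, forall x, wd (autf g x) = twist u p (wd x).
Proof.
move=> pK p'K pu.
have p'u b : ohead u = Some b -> p' b = b by move/pu => {1}<-; rewrite pK.
apply: (build_aut (f' := twist u p')) => [s|s|s _|s _|a s _|a s _].
- exact: twist_reduced (can_inj pK) pu.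
- exact: twist_reduced (can_inj p'K) p'u.
- exact: twistK.
- exact: twistK.
- by right.
- by right.
Qed.

Definition swap (a b c : 'I_5) : 'I_5 :=
  if c == a then b else if c == b then a else c.

Lemma swapK a b : involutive (swap a b).
Proof.
rewrite /swap => c; case: (c =P a) => [->|ca]; first by case: (b =P a); rewrite ?eqxx.
case: (c =P b) => [->|cb]; rewrite ?eqxx //.
by move/eqP/negbTE: ca => ->; move/eqP/negbTE: cb => ->.
Qed.

Lemma size_fix_origin (g : G) (x : T5) :
  autf g origin = origin -> size (wd (autf g x)) = size (wd x).
Proof. by move=> h; rewrite -!dist_origin -{1}h dist_aut. Qed.

Lemma parent_fix_origin (g : G) (x : T5) :
  autf g origin = origin -> autf g (parent x) = parent (autf g x).
Proof.
move=> h; apply: wd_inj.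
have sx := size_fix_origin x h; have sp := size_fix_origin (parent x) h.
case: (altP (wd x =P [::])) => [e|nx].
  have ex : x = origin by apply: wd_inj.
  have -> : parent x = x by apply: wd_inj; rewrite /= e.
  by rewrite ex h.
have sx' : size (wd x) = (size (wd (parent x))).+1 by rewrite /=; case: (wd x) nx.
case: (proj1 (aut_adj g _ _) (adj_parent nx)) => -[e1 e2] //.
by move: e2; rewrite -!/(wd _) sx sp sx' => /eqP; rewrite eqn_leq ltnNge leqnSn andbF.
Qed.

Lemma branch_transitive (q z z' : seq 'I_5) (x : T5) :
  wd x = z ++ q -> size z = size z' -> reduced (z' ++ q) ->
  exists2 g : G, (forall y, size (wd y) <= size q -> autf g y = y) &
    wd (autf g x) = z' ++ q.
Proof.
elim: z z' x => [|a z IH] [|a' z'] x // e.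
  by move=> _ _; exists gone.
move=> [hz]; rewrite cat_cons => rz'.
have rz : reduced (z' ++ q) := reduced_behead rz'.
have ep : wd (parent x) = z ++ q by rewrite /= e.
have [g gfix hg] := IH z' (parent x) ep hz rz.
have groot : autf g origin = origin by apply: gfix.
have [b eb] : exists b, wd (autf g x) = b :: z' ++ q.
  have := size_fix_origin x groot; rewrite e /=.
  have := parent_fix_origin x groot => /(congr1 wd); rewrite hg /= => ->.
  by case: (wd (autf g x)) => // b s _; exists b.
have rb : reduced (wd (autf g x)) := proj2_sig (autf g x).
move: rb rz'; rewrite eb !reduced_cons => /andP[hb _] /andP[ha' _].
have [k hk] : exists k : G, forall y, wd (autf k y) = twist (z' ++ q) (swap b a') (wd y).
  apply: (@twist_aut _ _ (swap b a')); try exact: swapK.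
  move=> c hc; move: hb ha'; rewrite hc /swap.
  by case: (c =P b) => [->|_]; rewrite ?eqxx //; case: (c =P a') => [->|_]; rewrite ?eqxx.
exists (gcomp k g).
  move=> y hy; apply: wd_inj; rewrite /autf /= -!/(autf _ _) gfix // hk twist_small //.
  by rewrite size_cat; lia.
by rewrite /autf /= -!/(autf _ _) hk eb -cat1s twist_beyond /= /swap eqxx.
Qed.

(** * Orbit growth *)

Fixpoint grow (q : seq 'I_5) (z : seq 'I_4) : seq 'I_5 :=
  if z is i :: z' then lift (head ord0 (grow q z')) i :: grow q z' else q.

Lemma grow_reduced q z : reduced q -> reduced (grow q z).
Proof.
move=> rq; elim: z => // i z IH.
have -> : grow q (i :: z) = lift (head ord0 (grow q z)) i :: grow q z by [].
rewrite reduced_cons IH andbT.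
case: (grow q z) => //= a s; apply/eqP => -[e].
by have := neq_lift a i; rewrite -e eqxx.
Qed.

Lemma grow_cat q z : exists2 z', size z' = size z & grow q z = z' ++ q.
Proof.
elim: z => [|i z [z' hz e]]; first by exists [::].
by exists (lift (head ord0 (grow q z)) i :: z'); rewrite /= ?hz // {2}e.
Qed.

Lemma grow_inj q z1 z2 : size z1 = size z2 -> grow q z1 = grow q z2 -> z1 = z2.
Proof.
elim: z1 z2 => [|i z1 IH] [|j z2] //= [hs] [] e1 e2.
have ez := IH _ hs e2; rewrite ez in e1 *.
by congr (_ :: _); apply: (@lift_inj 5 (head ord0 (grow q z2))); apply: val_inj.
Qed.

Lemma orbit_lower_bound (r : nat) (x : T5) (L : seq T5) :
  (forall g : G, (forall y, size (wd y) <= r -> autf g y = y) -> autf g x \in L) ->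
  4 ^ (size (wd x) - r) <= size L.
Proof.
move=> hL; case: (leqP (size (wd x)) r) => hr.
  have : x \in L by apply: (hL gone).
  by move/eqP: hr => ->; case: L {hL}.
set n := size (wd x) - r.
pose q := drop n (wd x).
have sq : size q = r by rewrite size_drop /n; lia.
have rq : reduced q by apply: drop_sorted; apply: (proj2_sig x).
have ex : wd x = take n (wd x) ++ q by rewrite cat_take_drop.
rewrite -[4]card_ord -card_tuple cardE -(size_map (grow q \o val)) -(size_map wd L).
apply: uniq_leq_size => [|s /mapP[t _ ->]].
  rewrite map_inj_uniq ?enum_uniq // => t1 t2 /= e.
  by apply/val_inj/(grow_inj _ e); rewrite !size_tuple.
have [z' hz e] := grow_cat q (val t).
have rz : reduced (z' ++ q) by rewrite -e grow_reduced.
have hs : size (take n (wd x)) = size z'.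
  by rewrite hz size_tuple size_takel // leq_subr.
have [g hg eg] := branch_transitive ex hs rz.
apply/mapP; exists (autf g x); last by rewrite eg /= e.
by apply: hL => y hy; apply: hg; rewrite sq.
Qed.

Lemma exponential_comparison (a b C : nat) :
  (forall n, b ^ n <= a ^ n * C) -> b <= a.
Proof.
move=> h; rewrite leqNgt; apply/negP => ab.
have bern n : a ^ n * (a + n) <= a * a.+1 ^ n.
  elim: n => [|n IH]; first by rewrite !expn0; lia.
  rewrite !expnS; move: (a ^ n) (a.+1 ^ n) IH => u v; nia.
have up n : a.+1 ^ n <= a ^ n * C by apply: leq_trans (h n); case: n => // n; rewrite leq_exp2r.
have [a0|a_gt0] := posnP a; first by have := up 1; rewrite a0.
have := bern (a * C).+1; have := up (a * C).+1.
have : 0 < a ^ (a * C).+1 by rewrite expn_gt0 a_gt0.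
move: (a ^ _) (a.+1 ^ _) => u v; nia.
Qed.

Definition small (X : Type) (n : nat) (P : X -> Prop) : Prop :=
  exists l : seq X, size l <= n /\ forall x, P x -> In x l.

Lemma In_cat (X : Type) (x : X) (s t : seq X) : In x (s ++ t) <-> In x s \/ In x t.
Proof. by elim: s => /= [|a s ->]; tauto. Qed.

Lemma In_mem (X : eqType) (x : X) (s : seq X) : In x s <-> x \in s.
Proof.
elim: s => //= a s IH; rewrite inE; split.
  by case=> [->|/IH ->]; rewrite ?eqxx ?orbT.
by case/orP => [/eqP ->|/IH]; [left | right].
Qed.

Lemma small_sub (X : Type) n (P Q : X -> Prop) :
  (forall x, P x -> Q x) -> small n Q -> small n P.
Proof. by move=> h [l [hl hQ]]; exists l; split=> // x /h /hQ. Qed.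

Lemma small_image (X Y : Type) (f : X -> Y) n (P : X -> Prop) :
  small n P -> small n (fun y => exists2 x, P x & y = f x).
Proof.
case=> l [hl hP]; exists (map f l); split; first by rewrite size_map.
by move=> _ [x /hP hx ->]; apply: in_map.
Qed.

Lemma small_bind (X Y : Type) n m (P : X -> Prop) (Q : X -> Y -> Prop) :
  small n P -> (forall x, P x -> small m (Q x)) ->
  small (n * m) (fun y => exists2 x, P x & Q x y).
Proof.
case=> l [hl hP] hQ.
have [L [hL LP]] : exists L : seq Y, size L <= size l * m /\
    forall x y, In x l -> P x -> Q x y -> In y L.
  elim: l {hl hP} => [|x l [L [hL LP]]]; first by exists [::].
  case: (classic (P x)) => [px|npx]; last first.
    exists L; split; first by rewrite mulSn; apply: leq_trans hL (leq_addl _ _).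
    by move=> x' y [<-|hx] px'; [case: (npx px') | apply: (LP x')].
  have [L' [hL' LQ]] := hQ x px.
  exists (L' ++ L); split; first by rewrite size_cat mulSn leq_add.
  move=> x' y [<-|hx] px' hy; apply/In_cat; [left|right]; first exact: LQ.
  exact: (LP x').
exists L; split; first by apply: leq_trans hL _; rewrite leq_mul2r hl orbT.
by move=> y [x px hy]; apply: (LP x) => //; apply: hP.
Qed.

Lemma small_exact (X : eqType) n (P : X -> Prop) :
  small n P -> exists A : seq X, forall x, x \in A <-> P x.
Proof.
case=> l [_ hP].
have [A hA] : exists A : seq X, forall x, x \in A <-> In x l /\ P x.
  elim: l {hP} => [|a l [A hA]]; first by exists [::] => x; split=> // -[].
  case: (classic (P a)) => h.
    exists (a :: A) => x; rewrite inE; split.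
      by case/orP => [/eqP ->|/hA []]; split=> //; [left | right].
    by case=> -[->|hx] px; rewrite ?eqxx //; apply/orP; right; apply/hA.
  exists A => x; split; first by case/hA => ? ?; split=> //; right.
  by case=> -[<-|hx] px //; apply/hA.
exists A => x; split; first by case/hA.
by move=> px; apply/hA; split=> //; apply: hP.
Qed.

Lemma gcompE (g h : G) x : autf (gcomp g h) x = autf g (autf h x).
Proof. by []. Qed.

Lemma gpowM (g : G) m n x : autf (gpow (gpow g m) n) x = autf (gpow g (m * n)) x.
Proof.
elim: n x => [|n IH] x; first by rewrite muln0.
by rewrite mulnS gpowD -IH.
Qed.

Lemma span_le_size (A : seq T5) (g : G) :
  span A (img g A) <= size (wd (autf g origin)) + 2 * span [:: origin] A.
Proof.
apply/span_leP => a _ ha /mapP[b hb ->].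
have ho : origin \in [:: origin] by rewrite mem_head.
have := dist_le_span ho ha; have := dist_le_span ho hb.
have := dist_triangle a origin (autf g b).
have := dist_triangle origin (autf g origin) (autf g b).
by rewrite dist_aut (dist_origin (autf g origin)) (distC a origin); lia.
Qed.

Lemma exists_reduced (q : seq 'I_5) (n : nat) : reduced q ->
  exists x : T5, wd x = grow q (nseq n ord0).
Proof. by move=> rq; exists (exist (fun s => reduced s) _ (grow_reduced (nseq n ord0) rq)). Qed.

Lemma size_grow q z : size (grow q z) = size z + size q.
Proof. by have [z' hz ->] := grow_cat q z; rewrite size_cat hz. Qed.

Lemma twist_comp u p p' s : twist u p (twist u p' s) = twist u (p \o p') s.
Proof. by elim: s => //= a s <-; rewrite suffix_twist; case: (suffix u s). Qed.

Lemma twist_id u p s : (forall a, p a = a) -> twist u p s = s.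
Proof. by move=> h; elim: s => //= a s ->; rewrite h; case: ifP. Qed.

Lemma lcp_cat s t t' : lcp (s ++ t) (s ++ t') = size s + lcp t t'.
Proof. by elim: s => //= a s ->; rewrite eqxx. Qed.

Definition two : 'I_5 := @Ordinal 5 2 isT.

Definition cyc3 (a : 'I_5) : 'I_5 :=
  match val a with
  | 2 => @Ordinal 5 3 isT
  | 3 => @Ordinal 5 4 isT
  | 4 => two
  | _ => a
  end.

Lemma cyc3K a : cyc3 (cyc3 (cyc3 a)) = a.
Proof. by apply: val_inj; case: a => -[|[|[|[|[|]]]]]. Qed.

Lemma cyc3_small (a : 'I_5) : a < 2 -> cyc3 a = a.
Proof. by case: a => -[|[|]]. Qed.

(** * Cayley-Abels graphs of small degree *)

Section CayleyAbels.

Variables (W : Type) (adjW : W -> W -> Prop) (act : G -> W -> W).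
Hypothesis ca : is_cayley_abels adjW act.
Variable w : W.

Definition stab (k : G) : Prop := act k w = w.

Lemma act_gone u : act gone u = u.
Proof. by case: ca => _ [_ [_ [_ [h _]]]]; apply: h. Qed.

Lemma act_comp g h u : act (gcomp g h) u = act g (act h u).
Proof. by case: ca => _ [_ [_ [_ [_ [h' _]]]]]; apply: h'. Qed.

Lemma act_ext g h u : (forall x, autf g x = autf h x) -> act g u = act h u.
Proof.
move=> e; rewrite -[RHS]act_gone.
by case: ca => _ [_ [_ [_ [_ [h' _]]]]]; apply: h'.
Qed.

Lemma actK g : cancel (act g) (act (ginv g)).
Proof.
by move=> u; rewrite -act_comp -[RHS]act_gone; apply: act_ext => x; apply: autK.
Qed.

Lemma actVK g : cancel (act (ginv g)) (act g).
Proof.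
by move=> u; rewrite -act_comp -[RHS]act_gone; apply: act_ext => x; apply: autVK.
Qed.

Lemma adjW_sym u v : adjW u v -> adjW v u.
Proof. by case: ca => h _; apply: h. Qed.

Lemma act_adj g u v : adjW u v <-> adjW (act g u) (act g v).
Proof. by case: ca => _ [_ [_ [_ [_ [_ [h _]]]]]]; case: (h g) => _; apply. Qed.

Lemma act_transitive u v : exists g, act g u = v.
Proof. by case: ca => _ [_ [_ [_ [_ [_ [_ [h _]]]]]]]; apply: h. Qed.

Lemma connectedW_ind (P : W -> Prop) :
  P w -> (forall u v, P u -> adjW u v -> P v) -> forall u, P u.
Proof.
move=> Pw Pstep u; have : clos_refl_trans W adjW w u.
  by case: ca => _ [_ [h _]]; apply: h.
move=> /clos_rt_rtn1_iff; elim=> // v v' a _ Pv; exact: Pstep a.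
Qed.

Lemma stab_gone : stab gone.
Proof. exact: act_gone. Qed.

Lemma stab_comp g h : stab g -> stab h -> stab (gcomp g h).
Proof. by rewrite /stab act_comp => hg ->. Qed.

Lemma stab_contains_ball_fixator :
  exists r, forall g : G, (forall y, size (wd y) <= r -> autf g y = y) -> stab g.
Proof.
case: ca => _ [_ [_ [_ [_ [_ [_ [_ h]]]]]]].
have [/(_ gone stab_gone) [F hF] _] := h w.
exists (\max_(x <- F) size (wd x)) => g hg; apply: hF => x /In_mem hx.
by apply: hg; apply: (@leq_bigmax_seq _ _ xpredT (fun x => size (wd x))).
Qed.

Lemma stab_orbit_finite : exists m, small m (fun y => exists2 k, stab k & y = autf k origin).
Proof.
case: ca => _ [_ [_ [_ [_ [_ [_ [_ h]]]]]]].
have [_ comp] := h w.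
have [||l hl] := comp T5 (fun y g => autf g origin = y).
- by move=> y g <-; exists [:: origin] => k; apply; left.
- by move=> g _; exists (autf g origin).
exists (size l), l; split=> // y [k /hl [i [hi e]] ->]; rewrite e; exact: hi.
Qed.

Lemma stab_bounded : exists c, forall k, stab k -> size (wd (autf k origin)) <= c.
Proof.
have [m [l [_ hl]]] := stab_orbit_finite.
exists (\max_(x <- l) size (wd x)) => k hk.
have /In_mem hx : In (autf k origin) l by apply: hl; exists k.
exact: (@leq_bigmax_seq _ _ xpredT (fun x => size (wd x))).
Qed.

Lemma orbit_pow_small (g : G) N m n :
  small N (fun v => exists2 k, stab k & v = act k (act g w)) ->
  small m (fun y => exists2 k, stab k & y = autf k origin) ->
  small (N ^ n * m)
    (fun y => exists2 k, stab k & y = autf k (autf (gpow g n) origin)).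
Proof.
move=> hN hm; elim: n => [|n IH]; first by rewrite expn0 mul1n.
rewrite expnS -mulnA.
pose Q v y := exists k, [/\ stab k, v = act k (act g w) &
  y = autf k (autf (gpow g n.+1) origin)].
apply: (small_sub (Q := fun y => exists2 v, (exists2 k, stab k & v = act k (act g w)) & Q v y)).
  by move=> y [k hk ->]; exists (act k (act g w)); exists k.
apply: small_bind hN _ => _ [k0 hk0 ->].
apply: small_sub (small_image (autf (gcomp k0 g)) IH) => y [k [hk e ->]].
exists (autf (gcomp (ginv (gcomp k0 g)) (gcomp k g)) (autf (gpow g n) origin)).
  exists (gcomp (ginv (gcomp k0 g)) (gcomp k g)) => //.
  by rewrite /stab !act_comp -e -(act_comp k0) actK.
by rewrite (gcompE (ginv _)) autVK.
Qed.

(* Counting the [K]-orbit of [g ^ n] applied to the origin: it is at least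
   [4 ^ (l * n)] in the tree and at most [N ^ n] in the graph, up to constants. *)
Lemma scale_bound (g : G) N l c :
  small N (fun v => exists2 k, stab k & v = act k (act g w)) ->
  (forall n, l * n <= size (wd (autf (gpow g n) origin)) + c) -> 4 ^ l <= N.
Proof.
move=> hN hg.
have [r hr] := stab_contains_ball_fixator.
have [m hm] := stab_orbit_finite.
apply: (@exponential_comparison _ _ (m * 4 ^ (c + r))) => n.
have [L [sL hL]] := orbit_pow_small n hN hm.
have := @orbit_lower_bound r (autf (gpow g n) origin) L.
move=> lb; rewrite -expnM mulnA.
apply: (@leq_trans (4 ^ ((size (wd (autf (gpow g n) origin)) - r) + (c + r)))).
  by rewrite leq_exp2l //; have := hg n; lia.
rewrite expnD leq_mul2r; apply/orP; right; apply: leq_trans sL; apply: lb.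
by move=> k hk; apply/In_mem; apply: hL; exists k => //; apply: hr.
Qed.

Lemma scale_of_nonelliptic (A : seq T5) (g : G) j N :
  A != [::] -> ~~ elliptic_at A g ->
  small N (fun v => exists2 k, stab k & v = act k (act (gpow g j) w)) ->
  4 ^ j <= N.
Proof.
move=> nA hyp hN.
apply: (scale_bound (c := 2 * span [:: origin] A) hN) => n.
rewrite gpowM; apply: leq_trans (span_le_size A _).
exact: span_pow_growth.
Qed.

Lemma stab_fixes_orbit : exists2 A : seq T5, A != [::] &
  forall k, stab k -> fixes_center A k.
Proof.
have [m /small_exact [A hA]] := stab_orbit_finite.
exists A.
  have : autf gone origin \in A by apply/hA; exists gone => //; apply: stab_gone.
  by case: A {hA}.
move=> k hk; apply/span_leP => a _ ha /mapP[b /hA [k' hk' ->] ->].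
apply: dist_le_span => //; apply/hA; exists (gcomp k k') => //.
exact: stab_comp.
Qed.

Lemma no_global_center (A : seq T5) : A != [::] ->
  (forall k, stab k -> fixes_center A k) ->
  (forall v, adjW w v -> exists2 g, act g w = v & fixes_center A g) -> False.
Proof.
move=> nA hK hN.
have cover : forall u, exists2 g, act g w = u & fixes_center A g.
  apply: connectedW_ind.
    by exists gone; [apply: act_gone | apply: hK stab_gone].
  move=> _ v [g <- hg] /(act_adj (ginv g)); rewrite actK => /hN [h eh hh].
  by exists (gcomp g h); [rewrite act_comp eh actVK | apply: fixes_center_comp].
have all_fix g : fixes_center A g.
  have [h eh hh] := cover (act g w).
  have hk : stab (gcomp (ginv h) g) by rewrite /stab act_comp -eh actK.
  have := fixes_center_comp nA hh (hK _ hk); rewrite /fixes_center /img.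
  by rewrite (@eq_map _ _ _ (autf g)) // => x; rewrite !gcompE autVK.
case: A nA {hK hN cover} all_fix => // a A _ all_fix.
have [y ey] := @exists_reduced [::] (span (a :: A) (a :: A) + size (wd a)).+1 isT.
have [g eg] := aut_transitive a y.
have ha : a \in a :: A by rewrite mem_head.
have := leq_trans (dist_le_span ha (map_f (autf g) ha)) (all_fix g).
have := dist_triangle origin a y.
rewrite eg !dist_origin ey size_grow size_nseq; lia.
Qed.

(* An element of order 3 fixing [w] fixes every neighbour with an orbit of size
   at most 2, hence acts trivially if all orbits on neighbours are that small; its
   conjugates then all lie in [stab], which bounds its displacement. *)
Lemma exists_large_suborbit :
  exists v k1 k2, [/\ adjW w v, stab k1, stab k2 &
    [/\ v <> act k1 v, v <> act k2 v & act k1 v <> act k2 v]].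
Proof.
apply: NNPP => none.
have [r hr] := stab_contains_ball_fixator.
pose u := grow [::] (nseq r ord0); have su : size u = r by rewrite size_grow size_nseq addn0.
have ru : reduced u by apply: grow_reduced.
have head_u b : ohead u = Some b -> b < 2.
  rewrite /u; case: (r) => //= n [<-] /=.
  by rewrite /bump leqn0; case: (_ == 0).
have [f fE] : exists f : G, forall x, wd (autf f x) = twist u cyc3 (wd x).
  apply: (@twist_aut _ _ (cyc3 \o cyc3)) => [a|a|b /head_u]; rewrite /= ?cyc3K //.
  exact: cyc3_small.
have f3 x : autf f (autf f (autf f x)) = x.
  by apply: wd_inj; rewrite !fE !twist_comp twist_id // => a; apply: cyc3K.
have ffix : stab f.
  by apply: hr => y hy; apply: wd_inj; rewrite fE twist_small // su.
have trivial_f : forall v, act f v = v.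
  apply: connectedW_ind => // v v' fv adj.
  have [g eg] := act_transitive w v.
  pose k := gcomp (ginv g) (gcomp f g).
  have hk : stab k by rewrite /stab /k !act_comp eg fv -eg actK.
  have hkk : stab (gcomp k k) by apply: stab_comp.
  have k3 y : act k (act k (act k y)) = y.
    rewrite /k !act_comp !actVK -!(act_comp f) -!act_comp -[RHS]act_gone.
    by apply: act_ext => z; rewrite !gcompE f3 autK.
  have adjg : adjW w (act (ginv g) v') by rewrite -(actK g w) eg -act_adj.
  suff e : act k (act (ginv g) v') = act (ginv g) v'.
    by move: e; rewrite /k !act_comp actVK => /(can_inj (actVK g)).
  apply: NNPP => ne; apply: none; exists (act (ginv g) v'), k, (gcomp k k).
  split=> //; rewrite act_comp; split.
  - by move=> e; apply: ne.
  - by move=> e; apply: ne; rewrite [in LHS]e k3.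
  - by move/(can_inj (actK k)) => e; apply: ne.
have [c hc] := stab_bounded.
have small_disp x : dist x (autf f x) <= c.
  have [g <-] := aut_transitive origin x.
  have := hc (gcomp (ginv g) (gcomp f g)).
  rewrite -dist_origin !gcompE -(dist_aut g) autVK; apply.
  by rewrite /stab !act_comp trivial_f actK.
have r2 : reduced (two :: u).
  rewrite reduced_cons ru andbT; apply/eqP => /head_u.
  by [].
have [x ex] := exists_reduced c r2.
have [z hz ez] := grow_cat (two :: u) (nseq c ord0).
have := small_disp x; rewrite /dist fE ex ez -cat_rcons twist_beyond.
rewrite !size_cat size_map size_rcons !rev_cat -map_rev rev_rcons map_cons.
rewrite lcp_cat /= addn0 size_rev hz size_nseq; lia.
Qed.

Section SmallDegree.

Variable d : nat.
Hypothesis deg_w : deg_at adjW w d.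
Hypothesis d_le4 : d <= 4.

Lemma star_of u : exists l, [/\ NoDup l, size l <= 4 & forall y, adjW u y <-> In y l].
Proof.
have [g <-] := act_transitive w u.
have [l [nl [sl hl]]] := deg_w.
have sl' : size l = d by rewrite -sl.
exists (List.map (act g) l); split.
- by apply: Injective_map_NoDup nl; apply: can_inj (actK g).
- by rewrite size_map sl'.
move=> y; rewrite -{1}(actVK g y) -act_adj hl; split.
  by move/(in_map (act g)); rewrite actVK.
by case/in_map_iff => z [<-]; rewrite actK.
Qed.

Lemma star_minus_small u v : adjW u v -> small 3 (fun y => adjW u y /\ y <> v).
Proof.
have [l [_ sl hl]] := star_of u.
move=> /hl /(@in_split W) [l1 [l2 e]].
exists (l1 ++ l2); split.
  move: sl; rewrite e -/(cat _ _) !size_cat /=; lia.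
move=> y [/hl hy ny]; apply/In_cat.
by move: hy; rewrite e -/(cat _ _) => /In_cat [|[|]]; auto; move=> ey; case: ny.
Qed.

Lemma neighbour_elliptic (A : seq T5) (s : G) :
  A != [::] -> adjW w (act s w) -> elliptic_at A s.
Proof.
move=> nA adj; apply/negPn/negP => hyp.
have e2 : act (gpow s 2) w = act s (act s w) by rewrite /= !act_comp act_gone.
case: (classic (act s (act s w) = w)) => [ew|nw].
  suff : 4 ^ 2 <= 1 by [].
  apply: (scale_of_nonelliptic (A := A) (g := s)) => //.
  exists [:: w]; split=> // v [k hk ->].
  by rewrite e2 ew; left.
suff : 4 ^ 2 <= 4 * 3 by [].
apply: (scale_of_nonelliptic (A := A) (g := s)) => //.
apply: (small_sub (Q := fun y => exists2 v, adjW w v & adjW v y /\ y <> w)).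
  move=> _ [k hk ->]; rewrite e2; exists (act k (act s w)).
    by rewrite -{1}hk -act_adj.
  rewrite -act_adj -act_adj; split=> // e; apply: nw.
  by rewrite -(actK k (act s (act s w))) e -{1}hk actK.
apply: small_bind => [|v adjv].
  by have [l [_ sl hl]] := star_of w; exists l; split=> // v /hl.
exact: star_minus_small (adjW_sym adjv).
Qed.

Lemma no_large_suborbit (s k1 k2 : G) : adjW w (act s w) -> stab k1 -> stab k2 ->
  act s w <> act k1 (act s w) -> act s w <> act k2 (act s w) ->
  act k1 (act s w) <> act k2 (act s w) -> False.
Proof.
move=> adjs hk1 hk2 n1 n2 n12.
have [A0 nA0 fixA0] := stab_fixes_orbit.
pose A1 := A0 ++ img s A0.
have nA1 : A1 != [::] by rewrite /A1; case: A0 nA0 {fixA0 A1}.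
have adj_stab k v : stab k -> adjW w v -> adjW w (act k v).
  by move=> hk adjv; rewrite -hk -act_adj.
have fixK1 k : stab k -> fixes_center A1 k.
  move=> hk; apply: fixes_center_join; rewrite ?fixA0 ?neighbour_elliptic //.
  by rewrite act_comp; apply: adj_stab.
have fixs1 : fixes_center A1 s.
  by apply: fixes_center_join_self; rewrite ?neighbour_elliptic.
case: (classic (exists2 v, adjW w v & forall k, stab k -> v <> act k (act s w))).
  case=> v adjv nv; have [t et] := act_transitive w v; subst v.
  pose L := [:: act s w; act k1 (act s w); act k2 (act s w); act t w].
  have starL y : adjW w y -> In y L.
    have [l [nl sl hl]] := star_of w.
    have sub : incl L l.
      by move=> z /= [<-|[<-|[<-|[<-|[]]]]]; apply/hl => //; apply: adj_stab.
    have nL : NoDup L.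
      have n3 : act s w <> act t w by move=> e; apply: (nv gone stab_gone); rewrite act_gone.
      have n4 := nv _ hk1; have n5 := nv _ hk2.
      repeat constructor => /=; intuition congruence.
    move=> /hl; apply: (NoDup_length_incl nL _ sub).
    by apply/leP.
  have fix_t k : stab k -> act k (act t w) = act t w.
    move=> hk; have /= := starL _ (adj_stab _ _ hk adjv).
    have no k' : stab k' -> act k' (act s w) = act k (act t w) -> False.
      move=> hk' e; apply: (nv (gcomp (ginv k) k')).
        by rewrite /stab act_comp hk' -{1}hk actK.
      by rewrite act_comp e actK.
    case=> [e|[/(no _ hk1)|[/(no _ hk2)|[|]]]] //.
    by case: (no gone stab_gone); rewrite act_gone.
  have elt k : stab k -> elliptic_at A1 (gcomp k t).
    by move=> hk; apply: neighbour_elliptic; rewrite ?act_comp ?fix_t.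
  have elt0 : elliptic_at A1 t by apply: neighbour_elliptic.
  have elst : elliptic_at A1 (gcomp s t).
    apply/negPn/negP => hyp; suff : 4 ^ 1 <= 3 by [].
    apply: (scale_of_nonelliptic (A := A1) (g := gcomp s t)) => //.
    pose h (v : W) := proj1_sig (constructive_indefinite_description _ (act_transitive w v)).
    have hE v : act (h v) w = v by rewrite /h; case: constructive_indefinite_description.
    exists (map (fun v => act (h v) (act t w)) [:: act s w; act k1 (act s w); act k2 (act s w)]).
    split=> // v [k hk ->].
    have -> : act k (act (gpow (gcomp s t) 1) w) =
        act (h (act k (act s w))) (act t w).
      rewrite /= !act_comp act_gone -(actVK (h (act k (act s w))) (act k _)).
      congr (act _ _).
      rewrite -[RHS](fix_t (gcomp (ginv (h (act k (act s w)))) (gcomp k s))) ?act_comp //.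
      by rewrite /stab !act_comp -{2}(hE (act k (act s w))) actK.
    have /= := starL _ (adj_stab _ _ hk adjs).
    case=> [<-|[<-|[<-|[e|//]]]]; rewrite /=; try tauto; by case: (nv k hk).
  have nA2 : A1 ++ img t A1 != [::] by case: A1 nA1 {fixK1 fixs1 elt elt0 elst}.
  have fixs2 : fixes_center (A1 ++ img t A1) s by apply: fixes_center_join.
  have fixK2 k : stab k -> fixes_center (A1 ++ img t A1) k.
    by move=> hk; apply: fixes_center_join; rewrite ?fixK1 ?elt.
  have fixt2 : fixes_center (A1 ++ img t A1) t by apply: fixes_center_join_self.
  apply: (no_global_center nA2 fixK2) => v /starL /= [<-|[<-|[<-|[<-|[]]]]].
  - by exists s.
  - by exists (gcomp k1 s); rewrite ?act_comp //; apply: fixes_center_comp => //; apply: fixK2.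
  - by exists (gcomp k2 s); rewrite ?act_comp //; apply: fixes_center_comp => //; apply: fixK2.
  - by exists t.
move=> none; apply: (no_global_center nA1 fixK1) => v adjv.
have [k hk ->] : exists2 k, stab k & v = act k (act s w).
  apply: NNPP => nk; apply: none; exists v => // k hk e.
  by apply: nk; exists k.
by exists (gcomp k s); [rewrite act_comp | apply: fixes_center_comp => //; apply: fixK1].
Qed.

End SmallDegree.
End CayleyAbels.

Lemma degree_lower_bound (W : Type) (adjW : W -> W -> Prop) (act : G -> W -> W) (w : W) (d : nat) :
  is_cayley_abels adjW act -> deg_at adjW w d -> 5 <= d.
Proof.
move=> ca dw; rewrite ltnNge; apply/negP => d4.
have [v [k1 [k2 [adjv hk1 hk2 [n1 n2 n12]]]]] := exists_large_suborbit ca w.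
have [s es] := act_transitive ca w v; subst v.
exact: (no_large_suborbit ca dw d4 adjv hk1 hk2).
Qed.

(** * The tree is a Cayley-Abels graph *)

Definition code (x : T5) : nat := pickle (wd x).

Lemma code_inj x y : code x = code y -> x = y.
Proof. by move/(pcan_inj pickleK)/wd_inj. Qed.

Definition agree (n : nat) (g h : G) : Prop :=
  forall x, code x < n -> autf h x = autf g x.

Definition has_finite_subcover (I : Type) (U : I -> G -> Prop) (P : G -> Prop) : Prop :=
  exists l : seq I, forall g, P g -> exists i, In i l /\ U i g.

Lemma finite_subcover_union (I : Type) (U : I -> G -> Prop) (X : finType)
    (P : G -> Prop) (Q : X -> G -> Prop) :
  (forall g, P g -> exists x, Q x g) ->
  (forall x, has_finite_subcover U (Q x)) -> has_finite_subcover U P.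
Proof.
move=> cov hQ.
have [L hL] : exists L : seq I, forall x, x \in enum X -> forall g, Q x g ->
    exists i, In i L /\ U i g.
  elim: (enum X) => [|x s [L hL]]; first by exists [::].
  have [l hl] := hQ x; exists (l ++ L) => y; rewrite inE.
  case/orP => [/eqP ->|ys] g Qg.
    by have [i [hi Ui]] := hl _ Qg; exists i; split=> //; apply/In_cat; left.
  by have [i [hi Ui]] := hL _ ys _ Qg; exists i; split=> //; apply/In_cat; right.
by exists L => g /cov [x]; apply: hL; rewrite mem_enum.
Qed.

Section Compactness.

Variables (I : Type) (U : I -> G -> Prop).

Definition uncovered (n : nat) (g : G) : Prop :=
  autf g origin = origin /\
  ~ has_finite_subcover U (fun h => autf h origin = origin /\ agree n g h).

(* Koenig's lemma: fixing the image of one more vertex leaves finitely many cases. *)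
Lemma uncovered_step n g :
  uncovered n g -> exists g', agree n g g' /\ uncovered n.+1 g'.
Proof.
case=> g0 unc; apply: NNPP => none; apply: unc.
have step h : autf h origin = origin -> agree n g h ->
    has_finite_subcover U (fun h' => autf h' origin = origin /\ agree n.+1 h h').
  by move=> h0 ah; apply: NNPP => nc; apply: none; exists h.
case: (classic (exists x, code x = n)) => [[x ex]|nx]; last first.
  have [l hl] := step g g0 (fun _ _ => erefl).
  exists l => h [h0 ah]; apply: hl; split=> // y; rewrite ltnS leq_eqVlt.
  by case/orP => [/eqP ey|]; [case: nx; exists y | apply: ah].
apply: (@finite_subcover_union _ U ((size (wd x)).-tuple 'I_5) _
  (fun t h => [/\ autf h origin = origin, agree n g h & wd (autf h x) = t])).
  move=> h [h0 ah].
  have st : size (wd (autf h x)) == size (wd x) by rewrite size_fix_origin.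
  by exists (Tuple st).
move=> t; case: (classic (exists h,
  [/\ autf h origin = origin, agree n g h & wd (autf h x) = t])); last first.
  by move=> nh; exists [::] => h Qh; case: nh; exists h.
case=> h [h0 ah hx]; have [l hl] := step h h0 ah.
exists l => h' [h'0 ah' h'x]; apply: hl; split=> // y; rewrite ltnS leq_eqVlt.
case/orP => [/eqP ey|ly]; last by rewrite ah // ah'.
by rewrite (@code_inj y x) ?ey //; apply: wd_inj; rewrite h'x.
Qed.

Lemma stabilizer_limit (g : nat -> G) :
  (forall n, autf (g n) origin = origin) -> (forall n, agree n (g n) (g n.+1)) ->
  exists h : G, forall n, agree n (g n) h.
Proof.
move=> g0 gS.
have gle m n : m <= n -> agree m (g m) (g n).
  move=> /subnK <-; elim: (n - m) => [|k IH] x hx //.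
  by rewrite addSn (gS _ x) ?IH //; apply: leq_trans hx (leq_addl _ _).
pose h x := autf (g (code x).+1) x.
have hE n x : code x < n -> h x = autf (g n) x by move=> hx; rewrite (gle _ _ hx).
have h_inj : injective h.
  move=> x y; rewrite !(hE (maxn (code x) (code y)).+1) ?ltnS ?leq_maxl ?leq_maxr //.
  exact: (can_inj (autK _)).
have h_surj y : exists x, h x = y.
  pose N := (\max_(t : (size (wd y)).-tuple 'I_5) pickle (val t)).+1.
  exists (autf (ginv (g N)) y); rewrite (hE N) ?autVK //.
  have sx : size (wd (autf (ginv (g N)) y)) == size (wd y).
    by rewrite -(size_fix_origin _ (g0 N)) autVK.
  by rewrite ltnS; apply: (leq_bigmax (Tuple sx)).
pose h' y := proj1_sig (constructive_indefinite_description _ (h_surj y)).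
have h'K : cancel h' h by move=> y; rewrite /h'; case: constructive_indefinite_description.
have is_aut : is_graph_aut T5adj h.
  split; first by exists h' => // x; apply: h_inj.
  move=> x y; pose n := (maxn (code x) (code y)).+1.
  by rewrite !(hE n) ?ltnS ?leq_maxl ?leq_maxr // -aut_adj.
by exists (exist _ h is_aut) => n x /hE.
Qed.

Lemma origin_stabilizer_compact :
  (forall i, perm_open (U i)) ->
  (forall g, autf g origin = origin -> exists i, U i g) ->
  has_finite_subcover U (fun g => autf g origin = origin).
Proof.
move=> oU cU; apply: NNPP => nc.
have unc0 : uncovered 0 gone.
  by split=> // -[l hl]; apply: nc; exists l => g hg; apply: hl.
pose next n (g : {g | uncovered n g}) : {g' | uncovered n.+1 g'} :=
  let s := constructive_indefinite_description _ (uncovered_step (proj2_sig g)) in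
  exist _ (proj1_sig s) (proj2 (proj2_sig s)).
pose chain := fix chain n : {g | uncovered n g} :=
  if n is m.+1 then next m (chain m) else exist _ gone unc0.
pose g n := proj1_sig (chain n).
have gS n : agree n (g n) (g n.+1).
  exact: (proj1 (proj2_sig (constructive_indefinite_description _
    (uncovered_step (proj2_sig (chain n)))))).
have g_unc n : uncovered n (g n) := proj2_sig (chain n).
have [h hh] := stabilizer_limit (fun n => proj1 (g_unc n)) gS.
have h0 : autf h origin = origin.
  by rewrite (hh (code origin).+1) // (proj1 (g_unc _)).
have [i Uih] := cU h h0.
have [F hF] := oU i h Uih.
pose N := (\max_(x <- F) code x).+1.
case: (proj2 (g_unc N)); exists [:: i] => k [_ ak]; exists i; split; first by left.
apply: hF => x /In_mem hx.
have lx : code x < N by rewrite ltnS; apply: (leq_bigmax_seq x hx).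
by rewrite ak // (hh N).
Qed.

End Compactness.

Lemma stabilizer_compact (v : T5) : perm_compact (fun g : G => autf g v = v).
Proof.
move=> I U oU cU; have [t et] := aut_transitive origin v.
pose conj g := gcomp t (gcomp g (ginv t)).
have [i g|g hg|l hl] := @origin_stabilizer_compact I (fun i g => U i (conj g)).
- move=> /(oU i) [F hF]; exists (map (autf (ginv t)) F) => h hh; apply: hF => x xF.
  by rewrite !gcompE hh //; apply: (in_map (autf (ginv t))).
- by apply: cU; rewrite !gcompE -et autK hg.
exists l => g hg; have [|i [hi Ui]] := hl (gcomp (ginv t) (gcomp g t)).
  by rewrite !gcompE et hg -et autK.
exists i; split=> //; have [F hF] := oU i _ Ui; apply: hF => x _.
by rewrite !gcompE !autVK.
Qed.

Lemma T5_connected (x y : T5) : clos_refl_trans T5 T5adj x y.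
Proof.
have to_origin z : clos_refl_trans T5 T5adj z origin.
  have [n] := ubnP (size (wd z)); elim: n z => // n IH z hz.
  case: (altP (wd z =P [::])) => [e|nz].
    by have -> : z = origin; [apply: wd_inj | apply: rt_refl].
  apply: (rt_trans _ _ _ (parent z)); first exact/rt_step/adj_parent.
  by apply: IH; rewrite /= size_behead; move: nz hz; case: (wd z).
have sym a b : clos_refl_trans T5 T5adj a b -> clos_refl_trans T5 T5adj b a.
  elim=> [c c' /adj_sym|c|c c' c'' _ h1 _ h2]; [exact: rt_step | exact: rt_refl |].
  exact: rt_trans h2 h1.
exact: rt_trans (to_origin x) (sym _ _ (to_origin y)).
Qed.

Lemma T5_degree (v : T5) : deg_at T5adj v 5.
Proof.
have [g <-] := aut_transitive origin v.
pose letter (a : 'I_5) : T5 := exist (fun s => reduced s) [:: a] isT.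
have letter_inj : injective letter by move=> a b [].
exists (List.map (fun a => autf g (letter a)) (enum 'I_5)); split; last split.
- apply: Injective_map_NoDup => [a b /(can_inj (autK g))/letter_inj //|].
  have : uniq (enum 'I_5) by apply: enum_uniq.
  elim: (enum 'I_5) => [_|a s IH /= /andP[na /IH us]]; first by constructor.
  by constructor=> // /In_mem; apply/negP.
- by rewrite List.length_map; apply: size_enum_ord.
move=> y; split.
  rewrite -[y](autVK g) -aut_adj => h; apply/in_map_iff.
  case: h => -[/= e1 e2]; last by [].
  move: e1 e2; case e: (proj1_sig _) => [|a [|b s]] //= _ _.
  exists a; split; last by apply/In_mem; rewrite mem_enum.
  by congr (autf g _); apply: wd_inj; rewrite /wd e.
case/in_map_iff => a [<- _]; rewrite -aut_adj.
by left.
Qed.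

Lemma T5_cayley_abels : is_cayley_abels T5adj T5act.
Proof.
split; first exact: adj_sym.
split.
  by move=> x; rewrite /T5adj => -[] [_ /eqP]; rewrite eqn_leq ltnn andbF.
split; first exact: T5_connected.
split; first by move=> x; have [l [_ [_ hl]]] := T5_degree x; exists l => y /hl.
split; first by move=> g v; apply.
split; first by move=> g h k v; apply.
split; first by move=> g; apply: (proj2_sig g).
split; first exact: aut_transitive.
move=> v; split; last exact: stabilizer_compact.
by move=> g gv; exists [:: v] => h hh; rewrite /T5act hh //; left.
Qed.

Theorem theorem6p1 :
  md_is T5adj 5 /\
  (is_cayley_abels T5adj T5act /\ forall v : T5, deg_at T5adj v 5).
Proof.
split; last by split; [exact: T5_cayley_abels | exact: T5_degree].
split.
  exists T5, T5adj, T5act; split; first exact: T5_cayley_abels.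
  by exists origin; apply: T5_degree.
by move=> W adjW act ca w d; apply: degree_lower_bound ca.
Qed.
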